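(* Consider the two-agent noisy-query allocation problem described in the context, with gap $\Delta>0$ (i.e., $\mathrm{OptEnvy}\le -\Delta$) and noise variance $\sigma^2>0$. Consider the following algorithm with query budget $q$: query each item $\tau=q/m$ times, obtaining $\{y^a_{i,t},y^b_{i,t}\}_{t=1}^{\tau}$; form $\widehat{\mu}^\nu_i=\frac1\tau\sum_{t=1}^\tau y^\nu_{i,t}$ for $\nu\in\{a,b\}$, $i\in[m]$; and, writing $\widehat{\mu}^\nu_S=\sum_{i\in S}\widehat{\mu}^\nu_i$, output the allocation $\mathcal{A}=(\mathcal{A}_a,\mathcal{A}_b)$ (over all partitions of $[m]$) maximizing $\min\{\widehat{\mu}^a_{\mathcal{A}_a}-\widehat{\mu}^a_{\mathcal{A}_b},\ \widehat{\mu}^b_{\mathcal{A}_b}-\widehat{\mu}^b_{\mathcal{A}_a}\}$. Then for any $\delta\in(0,1)$, this algorithm outputs an envy-free allocation with probability at least $1-\delta$ when the number of queries is set to $$q=m\left\lceil 32\sigma^2\log(4m/\delta)\cdot \frac{m^2}{\Delta^2}\right\rceil,$$ which is $\widetilde{O}(m^3/\Delta^2)$.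
   Context: Two agents $a,b$ and $m$ indivisible items $[m]=\{1,\dots,m\}$. Agent $\nu\in\{a,b\}$ has an unknown utility $\mu^\nu_i\in[0,1]$ for item $i$, and utilities are additive: the value of a set $S$ to $\nu$ is $\sum_{i\in S}\mu^\nu_i$. An allocation is a partition $\mathcal{A}=(\mathcal{A}_a,\mathcal{A}_b)$ of $[m]$. $\mathrm{Envy}_{a\to b}(\mathcal{A})=\sum_{i\in\mathcal{A}_b}\mu^a_i-\sum_{i\in\mathcal{A}_a}\mu^a_i$, $\mathrm{Envy}_{b\to a}(\mathcal{A})=\sum_{i\in\mathcal{A}_a}\mu^b_i-\sum_{i\in\mathcal{A}_b}\mu^b_i$, $\mathrm{Envy}(\mathcal{A})=\max\{\mathrm{Envy}_{a\to b}(\mathcal{A}),\mathrm{Envy}_{b\to a}(\mathcal{A})\}$; $\mathcal{A}$ is envy-free if $\mathrm{Envy}(\mathcal{A})\le 0$. $\mathrm{OptEnvy}=\min_{\mathcal{A}}\mathrm{Envy}(\mathcal{A})$. A query to item $i$ returns a pair $(y^a,y^b)$ with $y^\nu\sim N(\mu^\nu_i,\sigma^2)$; all query outcomes (across queries and across the two agents) are independent. $q$ is the total number of queries. $\log$ is the natural logarithm; $\widetilde O$ hides logarithmic factors. *)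

(* Defs.v *)
From HB Require Import structures.
From mathcomp Require Import all_boot all_order all_algebra.
From mathcomp Require Import all_classical all_reals all_analysis.
Set Implicit Arguments. Unset Strict Implicit. Unset Printing Implicit Defensive.
Import Order.TTheory GRing.Theory Num.Theory.
Local Open Scope classical_set_scope.
Local Open Scope ring_scope.

(* Agents are encoded by bool: true = agent a, false = agent b.
   An allocation (A_a, A_b) of [m] = 'I_m is encoded by the set S = A_a;
   then A_b = ~: S.  This is a bijection with the ordered partitions. *)

Section Envy.
Variables (R : realType) (m : nat).

Definition bval (u : 'I_m -> R) (S : {set 'I_m}) : R := \sum_(i in S) u i.

Definition envy_ab (mu : bool -> 'I_m -> R) (S : {set 'I_m}) : R :=
  bval (mu true) (~: S) - bval (mu true) S.
Definition envy_ba (mu : bool -> 'I_m -> R) (S : {set 'I_m}) : R :=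
  bval (mu false) S - bval (mu false) (~: S).

Definition envy (mu : bool -> 'I_m -> R) (S : {set 'I_m}) : R :=
  Num.max (envy_ab mu S) (envy_ba mu S).

Definition envy_free (mu : bool -> 'I_m -> R) (S : {set 'I_m}) : Prop :=
  envy mu S <= 0.

(* OptEnvy <= -Delta : the minimum over all allocations is at most -Delta *)
Definition opt_envy_le (mu : bool -> 'I_m -> R) (c : R) : Prop :=
  exists S : {set 'I_m}, envy mu S <= c.

Definition alg_obj (hmu : bool -> 'I_m -> R) (S : {set 'I_m}) : R :=
  Num.min (bval (hmu true) S - bval (hmu true) (~: S))
          (bval (hmu false) (~: S) - bval (hmu false) S).

Definition is_maximizer (f : {set 'I_m} -> R) (S : {set 'I_m}) : Prop :=
  forall S' : {set 'I_m}, f S' <= f S.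

End Envy.

Section Prob.
Context {d : measure_display} {T : measurableType d} {R : realType}.
Variable (P : probability T R).

Definition mutually_independent (I : eqType) (X : I -> {RV P >-> R}) : Prop :=
  forall (J : seq I) (B : I -> set R),
    uniq J -> (forall i, measurable (B i)) ->
    P (\bigcap_(j in [set` J]) (X j @^-1` B j)) =
    (\prod_(j <- J) P (X j @^-1` B j))%E.

End Prob.

Definition emp_mean {d : measure_display} {T : measurableType d} {R : realType}
  {P : probability T R} (m tau : nat)
  (Y : bool -> 'I_m -> nat -> {RV P >-> R}) (w : T) : bool -> 'I_m -> R :=
  fun nu i => (tau%:R)^-1 * \sum_(t < tau) Y nu i t w.

Definition tau_of {R : realType} (m : nat) (sigma delta Delta : R) : nat :=
  `| Num.ceil (32 * sigma ^+ 2 * ln (4 * m%:R / delta) * (m%:R ^+ 2) / Delta ^+ 2) |%N.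

(* Main.v *)
(* With eps = Delta/(2m), Chernoff's bound for sums of independent Gaussians
   gives P(|hat mu^nu_i - mu^nu_i| >= eps) <= 2 exp(-tau eps^2/(2 sigma^2))
   <= 2 delta/(4m), and a union bound over the 2m pairs (nu, i) leaves
   probability at most delta.  Otherwise the empirical envy of every allocation
   is within m eps = Delta/2 of the true one, so the empirical minimizer has
   true envy at most -Delta + 2 m eps = 0.  The exponential moment of a product
   splits by independence, and each factor is computed by completing the square
   in the Gaussian density. *)
Require Import Defs.
From HB Require Import structures.
From mathcomp Require Import all_boot all_order all_algebra.
From mathcomp Require Import all_classical all_reals all_analysis.
From mathcomp Require Import measurable_realfun ring lra.
Set Implicit Arguments. Unset Strict Implicit.
Import Order.TTheory GRing.Theory Num.Theory.
Local Open Scope classical_set_scope.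
Local Open Scope ring_scope.

(** * Weighted integrals determined by their values on indicators *)

Section Transfer.
Context {d' : measure_display} {T' : measurableType d'} {R : realType}.
Local Open Scope ereal_scope.
Import HBNNSimple.

(** Monotone convergence along the simple functions [h n]. The right side depends on [mu], [X] and
    [W] only through weighted integrals of indicators, so two such triples can be compared term by
    term. *)
Let simple_approximation (g : T' -> R) (mg : measurable_fun setT (EFin \o g))
    (d : measure_display) (T : measurableType d)
    (mu : {measure set T -> \bar R}) (X : T -> T') (W : T -> R) :
  (forall x, 0 <= g x)%R -> (forall x, 0 <= W x)%R ->
  measurable_fun setT X -> measurable_fun setT W ->
  let h := nnsfun_approx measurableT mg in
  \int[mu]_x (g (X x) * W x)%:E =
  limn (fun n => \sum_(k \in range (h n))
    k%:E * \int[mu]_x (\1_(h n @^-1` [set k]) (X x) * W x)%:E).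
Proof.
move=> g0 W0 mX mW h.
have mhX n : measurable_fun setT (h n \o X) by exact: measurableT_comp.
transitivity (limn (fun n => \int[mu]_x (h n (X x) * W x)%:E)).
  rewrite -monotone_convergence//.
  - apply: eq_integral => x _; apply/esym/cvg_lim => //.
    under eq_fun do rewrite EFinM.
    rewrite EFinM; apply: cvgeZr => //.
    by apply: (@cvg_nnsfun_approx _ _ _ _ _ _ mg) => // y _; rewrite lee_fin.
  - by move=> n; apply/measurable_EFinP/measurable_funM => //; exact: mhX.
  - by move=> n x _; rewrite lee_fin mulr_ge0.
  - move=> x _ a b ab; rewrite lee_fin ler_wpM2r//.
    exact/lefP/nd_nnsfun_approx.
congr (limn _); apply/funext => n.
have mI k : measurable_fun setT (fun x => \1_(h n @^-1` [set k]) (X x) * W x)%R.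
  apply: measurable_funM => //; apply: measurableT_comp => //.
rewrite (eq_integral (fun x => \sum_(k \in range (h n))
    (k * (\1_(h n @^-1` [set k]) (X x) * W x))%:E)); last first.
  move=> x _; rewrite fsumEFin// (fimfunE (h n)); congr EFin.
  rewrite !fsbig_finite//= mulr_suml.
  by apply: eq_bigr => k _; rewrite mulrA.
(* A negative [k] does no harm: where the indicator is nonzero, [k] equals [h n (X x)], which is
   nonnegative. *)
have kI0 k x : (0 <= k * (\1_(h n @^-1` [set k]) (X x) * W x))%R.
  rewrite mulrA mulr_ge0// indicE.
  case: (boolP (X x \in _)); last by rewrite mulr0.
  by rewrite inE /= => <-; rewrite mulr1.
rewrite ge0_integral_fsum//; last 2 first.
- by move=> k; apply/measurable_EFinP; apply: measurable_funM.
- by move=> k x _; rewrite lee_fin.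
apply: eq_fsbigr => k; rewrite inE => -[y _ <-].
under eq_integral do rewrite EFinM.
rewrite ge0_integralZl//.
- exact/measurable_EFinP.
- by move=> x _; rewrite lee_fin mulr_ge0.
- by rewrite lee_fin.
Qed.

(* Serves both for change of density (X2 = id, W2 a density) and for
   independence (W1 a product of the other factors, W2 a constant). *)
Lemma ge0_integral_transfer
    (d1 d2 : measure_display) (T1 : measurableType d1) (T2 : measurableType d2)
    (mu1 : {measure set T1 -> \bar R}) (mu2 : {measure set T2 -> \bar R})
    (X1 : T1 -> T') (X2 : T2 -> T') (W1 : T1 -> R) (W2 : T2 -> R) (g : T' -> R) :
  measurable_fun setT X1 -> measurable_fun setT X2 ->
  measurable_fun setT W1 -> measurable_fun setT W2 ->
  (forall x, 0 <= W1 x)%R -> (forall x, 0 <= W2 x)%R ->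
  measurable_fun setT g -> (forall x, 0 <= g x)%R ->
  (forall B, measurable B -> \int[mu1]_x (\1_B (X1 x) * W1 x)%:E =
                             \int[mu2]_x (\1_B (X2 x) * W2 x)%:E) ->
  \int[mu1]_x (g (X1 x) * W1 x)%:E = \int[mu2]_x (g (X2 x) * W2 x)%:E.
Proof.
move=> mX1 mX2 mW1 mW2 W10 W20 /measurable_EFinP mg g0 H.
rewrite !(@simple_approximation _ mg)//.
congr (limn _); apply/funext => n; apply: eq_fsbigr => k _.
by rewrite H.
Qed.

End Transfer.

(** * Product rule for expectations of independent variables *)

Section Independence.
Context {d : measure_display} {T : measurableType d} {R : realType}.
Variable P : probability T R.

Lemma integral_prod_indep (I : eqType) (X : I -> {RV P >-> R}) (J : seq I)
    (g : I -> R -> R) (c : I -> R) :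
  mutually_independent X -> uniq J ->
  (forall i, measurable_fun setT (g i)) -> (forall i x, 0 <= g i x) ->
  (forall i, \int[P]_w (g i (X i w))%:E = (c i)%:E)%E ->
  (\int[P]_w (\prod_(j <- J) g j (X j w))%:E = (\prod_(j <- J) c j)%:E)%E.
Proof.
move=> indX uJ.
(* Induction on a list s of the indices whose g j may fail to be an indicator;
   when all are indicators, the claim is the product rule for events. *)
suff H (s : seq I) : forall (g : I -> R -> R) (c : I -> R),
    (forall i, measurable_fun setT (g i)) ->
    (forall i x, 0 <= g i x) ->
    (forall i, \int[P]_w (g i (X i w))%:E = (c i)%:E)%E ->
    (forall j, j \in J -> j \notin s ->
       exists2 B, measurable B & g j = \1_B) ->
    (\int[P]_w (\prod_(j <- J) g j (X j w))%:E = (\prod_(j <- J) c j)%:E)%E.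
  by move=> mg g0 gc; apply: (H J) => // j ->.
elim: s => [|k s IH] {}g {}c mg g0 gc gI.
  (* Independence asks for a measurable set at every index; [setT] fills in off [J]. *)
  have gI' j : exists B, measurable B /\ (j \in J -> g j = \1_B).
    have [jJ|jJ] := boolP (j \in J); last by exists setT; split.
    by have [B mB gB] := gI j jJ isT; exists B.
  have [B HB] := choice gI'.
  have -> : (\int[P]_w (\prod_(j <- J) g j (X j w))%:E =
      \int[P]_w (\1_(\bigcap_(j in [set` J]) (X j @^-1` B j)) w)%:E)%E.
    apply: eq_integral => w _; congr EFin; rewrite indicE.
    have [wB|wB] := boolP (w \in _).
      rewrite big_seq big1// => j jJ; rewrite (HB j).2// indicE mem_set//.
      by move: wB; rewrite inE => /(_ j); apply.
    have [j jJ wj] : exists2 j, j \in J & ~ B j (X j w).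
      apply: contrapT => h; move: wB; rewrite notin_setE; apply => j /= jJ.
      by apply: contrapT => nB; apply: h; exists j.
    apply/eqP; rewrite prodf_seq_eq0; apply/hasP; exists j => //=.
    by rewrite (HB j).2// indicE memNset.
  rewrite integral_indic//; last first.
    by apply: fin_bigcap_measurable => // j _; apply: measurable_funPTI;
       exact: (HB j).1.
  rewrite setIT; etransitivity; first exact: (indX J B uJ (fun j => (HB j).1)).
  rewrite -prodEFin big_seq [RHS]big_seq; apply: eq_bigr => j jJ.
  rewrite -gc (HB j).2//.
  have mj : measurable (X j @^-1` B j).
    by apply: measurable_funPTI; exact: (HB j).1.
  transitivity (P ((X j @^-1` B j) `&` setT)); first by rewrite setIT.
  by rewrite -integral_indic.
have [kJ|kJ] := boolP (k \in J); last first.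
  apply: IH => // j jJ js; apply: gI => //.
  by rewrite inE negb_or js andbT; apply: contra kJ => /eqP <-.
have mX j : measurable_fun setT (X j) by exact: measurable_funP.
have mgX j : measurable_fun setT (fun w => g j (X j w)).
  exact: (measurableT_comp (mg j) (mX j)).
rewrite (big_rem k)//= mulrC EFinM -gc.
under eq_integral do rewrite (big_rem k)//=.
have c0 j : 0 <= c j.
  by rewrite -lee_fin -gc; apply: integral_ge0 => w _; rewrite lee_fin.
have cr0 : 0 <= \prod_(j <- rem k J) c j by exact: prodr_ge0.
rewrite (ge0_integral_transfer (W2 := fun=> \prod_(j <- rem k J) c j)
  (X2 := X k) (mu2 := P))//.
- under eq_integral do rewrite EFinM.
  rewrite ge0_integralZr ?lee_fin//; first by rewrite muleC.
  exact/measurable_EFinP.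
- by move=> w _; rewrite lee_fin.
- by apply: measurable_prod => j _; exact: mgX.
- by move=> w; apply: prodr_ge0.
move=> B mB.
have mXB : measurable (X k @^-1` B) by exact: measurable_funPTI.
(* With [g k] replaced by an indicator, [k] leaves the exceptional list and the induction hypothesis
   applies to [g']; [c'] records the new expectations. *)
pose g' j := if j == k then \1_B else g j.
pose c' j := if j == k then fine (P (X k @^-1` B)) else c j.
have E1B : (\int[P]_w (\1_B (X k w))%:E = P (X k @^-1` B))%E.
  transitivity (P ((X k @^-1` B) `&` setT)); last by rewrite setIT.
  by rewrite -integral_indic.
have : (\int[P]_w (\prod_(j <- J) g' j (X j w))%:E = (\prod_(j <- J) c' j)%:E)%E.
  apply: IH; rewrite /g' /c'.
  - by move=> j; case: ifP => // _; exact: measurable_indic.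
  - by move=> j x; case: ifP.
  - move=> j; case: ifPn => [/eqP ->|_]; last exact: gc.
    by rewrite E1B fineK// fin_num_measure.
  - move=> j jJ js; case: ifPn => [_|jk]; first by exists B.
    by apply: gI => //; rewrite inE negb_or jk.
have gg' w : \prod_(j <- J) g' j (X j w) =
    \1_B (X k w) * \prod_(j <- rem k J) g j (X j w).
  rewrite (big_rem k)//= {1}/g' eqxx; congr (_ * _).
  rewrite big_seq [RHS]big_seq; apply: eq_bigr => j.
  by rewrite mem_rem_uniq// inE /g' => /andP[/negbTE -> _].
have cc' : \prod_(j <- J) c' j =
    fine (P (X k @^-1` B)) * \prod_(j <- rem k J) c j.
  rewrite (big_rem k)//= {1}/c' eqxx; congr (_ * _).
  rewrite big_seq [RHS]big_seq; apply: eq_bigr => j.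
  by rewrite mem_rem_uniq// inE /c' => /andP[/negbTE -> _].
rewrite cc' => E; under eq_integral do rewrite -gg'.
rewrite E.
under [in RHS]eq_integral do rewrite EFinM.
rewrite ge0_integralZr ?lee_fin//.
  by rewrite E1B EFinM fineK// fin_num_measure.
by apply/measurable_EFinP/measurableT_comp => //; exact: measurable_indic.
Qed.

End Independence.

(** * Gaussian exponential moments and tail bound *)

Section NormalTail.
Context {d : measure_display} {T : measurableType d} {R : realType}.
Variable P : probability T R.

(** Completing the square: a (x - mu) - (x - mu)^2 / (2 sigma^2) = a^2 sigma^2 / 2 - (x - mu - a
    sigma^2)^2 / (2 sigma^2). Up to a constant factor the tilt only shifts the mean. *)
Lemma expR_normal_pdf (mu sigma a b x : R) : sigma != 0 ->
  expR (a * (x - mu) + b) * normal_pdf mu sigma x =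
  expR (a ^+ 2 * sigma ^+ 2 / 2 + b) * normal_pdf (mu + a * sigma ^+ 2) sigma x.
Proof.
move=> s0; rewrite /normal_pdf (negbTE s0) /normal_fun.
rewrite mulrCA [RHS]mulrCA -!expRD; congr (_ * expR _).
by field.
Qed.

(** After the tilt a normal density of mass 1 remains. The offset [b] will carry each factor's share
    of the Chernoff threshold. *)
Lemma integral_expR_normal (X : {RV P >-> R}) (mu sigma a b : R) :
  sigma != 0 ->
  (forall A, measurable A -> distribution P X A = normal_prob mu sigma A) ->
  (\int[P]_w (expR (a * (X w - mu) + b))%:E =
   (expR (a ^+ 2 * sigma ^+ 2 / 2 + b))%:E)%E.
Proof.
move=> s0 HX.
have mg : measurable_fun setT (fun x : R => expR (a * (x - mu) + b)).
  apply: measurableT_comp => //=; apply: measurable_funD => //.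
  by apply: measurable_funM => //; exact: measurable_funB.
under eq_integral do rewrite -[expR _]mulr1.
rewrite (ge0_integral_transfer (W1 := fun=> 1) (W2 := normal_pdf mu sigma)
  (X2 := @id R) (mu2 := lebesgue_measure)
  (g := fun x : R => expR (a * (x - mu) + b)))//.
- under eq_integral do rewrite expR_normal_pdf// EFinM.
  rewrite ge0_integralZl//.
  + by rewrite integral_normal_pdf mule1.
  + by apply/measurable_EFinP; exact: measurable_normal_pdf.
  + by move=> x _; rewrite lee_fin normal_pdf_ge0.
- exact: measurable_normal_pdf.
- by move=> x; exact: normal_pdf_ge0.
move=> B mB; under eq_integral do rewrite mulr1.
transitivity (P ((X @^-1` B) `&` setT)).
  by rewrite -integral_indic//; exact: measurable_funPTI.
rewrite setIT; transitivity (normal_prob mu sigma B); first exact: HX.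
rewrite /normal_prob [LHS]integral_mkcond.
apply: eq_integral => x _.
by rewrite patchE indicE; case: ifP => _; rewrite ?mul1r ?mul0r.
Qed.

(** Markov's inequality for the exponential of the sum, whose expectation factors by independence.
    As [a] is 1 or -1, both tails are covered. *)
Lemma normal_sum_tail (I : eqType) (X : I -> {RV P >-> R}) (J : seq I)
    (mu : I -> R) (sigma eps a : R) :
  mutually_independent X -> uniq J -> 0 < sigma -> 0 < eps -> a ^+ 2 = 1 ->
  (forall i A, measurable A ->
     distribution P (X i) A = normal_prob (mu i) sigma A) ->
  (P [set w | (size J)%:R * eps <= a * \sum_(j <- J) (X j w - mu j)]%R <=
   (expR (- (size J)%:R * eps ^+ 2 / (2 * sigma ^+ 2)))%:E)%E.
Proof.
move=> indX uJ s0 e0 a1 HX.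
have sn0 : sigma != 0 by rewrite gt_eqF.
have mX j : measurable_fun setT (X j) by exact: measurable_funP.
have mS : measurable_fun setT (fun w => a * \sum_(j <- J) (X j w - mu j)).
  apply: measurable_funM => //; apply: measurable_sum => j.
  exact: measurable_funB.
set A := [set w | _].
have mA : measurable A.
  by rewrite -[A]setTI; apply: measurable_fun_le => //; exact: measurable_cst.
(* This l minimizes the Chernoff exponent l^2 sigma^2 / 2 - l eps. *)
pose l := eps / sigma ^+ 2.
pose g i x := expR (l * a * (x - mu i) + - (l * eps)).
have mg i : measurable_fun setT (g i).
  apply: measurableT_comp => //=; apply: measurable_funD => //.
  by apply: measurable_funM => //; exact: measurable_funB.
have gE i : (\int[P]_w (g i (X i w))%:E =
    (expR ((l * a) ^+ 2 * sigma ^+ 2 / 2 + - (l * eps)))%:E)%E.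
  by apply: integral_expR_normal => // A0; exact: HX.
have gprod w : \prod_(j <- J) g j (X j w) =
    expR (l * (a * \sum_(j <- J) (X j w - mu j) - (size J)%:R * eps)).
  rewrite -expR_sum; congr expR.
  rewrite big_split/= -mulr_sumr big_const_seq count_predT iter_addr_0.
  by rewrite mulrBr -mulr_natl; ring.
(* Since a^2 = 1, each factor has exponent eps^2 / (2 sigma^2) - eps^2 / sigma^2 by the choice of
   [l]. *)
have -> : expR (- (size J)%:R * eps ^+ 2 / (2 * sigma ^+ 2)) =
    \prod_(j <- J) expR ((l * a) ^+ 2 * sigma ^+ 2 / 2 + - (l * eps)).
  rewrite -expR_sum; congr expR; rewrite big_const_seq count_predT iter_addr_0.
  by rewrite exprMn a1 -mulr_natl /l; field.
rewrite -(integral_prod_indep indX uJ mg _ gE); last first.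
  by move=> i x; exact: expR_ge0.
have -> : P A = (\int[P]_w (\1_A w)%:E)%E by rewrite integral_indic// setIT.
apply: ge0_le_integral => //.
- exact/measurable_EFinP/measurable_indic.
- apply/measurable_EFinP; apply: measurable_prod => j _.
  exact: (measurableT_comp (mg j) (mX j)).
move=> w _; rewrite gprod lee_fin indicE.
have [wA|_] := boolP (w \in A); last exact: expR_ge0.
move: wA; rewrite inE /A/= => wA.
rewrite -[leLHS]expR0 ler_expR mulr_ge0 ?subr_ge0//.
by rewrite divr_ge0 ?ltW// exprn_gt0.
Qed.

Lemma probability_bigsetU_le (I : Type) (s : seq I) (A : I -> set T) :
  (forall i, measurable (A i)) ->
  (P (\big[setU/set0]_(i <- s) A i) <= \sum_(i <- s) P (A i))%E.
Proof.
move=> mA; elim: s => [|i s IH]; first by rewrite !big_nil measure0.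
rewrite !big_cons (le_trans (measureU2 P (mA i) _))//.
  exact: bigsetU_measurable.
exact: leeD2l.
Qed.

End NormalTail.

(** * Stability of envy under errors in the utilities *)

Section Robustness.
Variables (R : realType) (m : nat).

Lemma alg_objE (h : bool -> 'I_m -> R) S : alg_obj h S = - envy h S.
Proof. by rewrite /alg_obj /envy /envy_ab /envy_ba oppr_max !opprB. Qed.

(** In a single signed sum over all items, errors of [eps] per item add up to at most [m * eps]
    whatever [S] is. *)
Lemma bval_diff (u : 'I_m -> R) (S : {set 'I_m}) :
  bval u S - bval u (~: S) = \sum_i (if i \in S then u i else - u i).
Proof.
rewrite /bval [RHS](bigID (fun i => i \in S))/= -sumrN; congr (_ + _).
  by apply: eq_bigr => i ->.
by apply: eq_big => i; rewrite inE// => /negbTE ->.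
Qed.

Lemma envy_close (h mu : bool -> 'I_m -> R) (eps : R) (S : {set 'I_m}) :
  (forall nu i, `|h nu i - mu nu i| <= eps) ->
  envy h S <= envy mu S + m%:R * eps.
Proof.
move=> close.
have diff nu : `|(bval (h nu) S - bval (h nu) (~: S)) -
    (bval (mu nu) S - bval (mu nu) (~: S))| <= m%:R * eps.
  rewrite !bval_diff -sumrB (le_trans (ler_norm_sum _ _ _))//.
  rewrite -[m in m%:R]card_ord mulr_natl -sumr_const; apply: ler_sum => i _.
  by case: ifP => _; rewrite // -opprD normrN close.
have := diff true; have := diff false; rewrite !ler_norml.
rewrite /envy ge_max /envy_ab /envy_ba => /andP[b1 b2] /andP[a1 a2].
by apply/andP; split; rewrite -lerBlDr le_max; apply/orP;
  [left|right]; lra.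
Qed.

(** [alg_obj] is minus the envy, so [S] minimizes the envy under [h]; comparison with a witness [S0]
    of the gap costs [m * eps] once for [S] and once for [S0]. *)
Lemma maximizer_envy_free (h mu : bool -> 'I_m -> R) (eps Delta : R)
    (S : {set 'I_m}) :
  (forall nu i, `|h nu i - mu nu i| <= eps) -> 2 * (m%:R * eps) <= Delta ->
  opt_envy_le mu (- Delta) -> is_maximizer (alg_obj h) S -> envy_free mu S.
Proof.
move=> close epsD [S0 HS0] /(_ S0); rewrite !alg_objE lerN2 /envy_free => Smax.
have := envy_close S0 close.
have close' nu i : `|mu nu i - h nu i| <= eps by rewrite distrC.
by have := envy_close S close'; lra.
Qed.

End Robustness.

(** * Nonemptiness, sample size and measurability *)

Lemma opt_envy_lt0_gt0 (R : realType) (m : nat) (mu : bool -> 'I_m -> R) (c : R) :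
  opt_envy_le mu c -> c < 0 -> (0 < m)%N.
Proof.
move=> [S envyS] c0; rewrite lt0n; apply/eqP => meq0.
have bv u S' : @bval R m u S' = 0.
  rewrite /bval big1// => i _.
  by have := leq_ltn_trans (leq0n i) (ltn_ord i); rewrite meq0.
by move: envyS; rewrite /envy /envy_ab /envy_ba !bv !subr0 maxxx leNgt c0.
Qed.

(** The absolute value that turns the ceiling into a natural number never decreases it. *)
Lemma tau_of_ge (R : realType) (m : nat) (sigma delta Delta : R) :
  32 * sigma ^+ 2 * ln (4 * m%:R / delta) * m%:R ^+ 2 / Delta ^+ 2 <=
  (tau_of m sigma delta Delta)%:R.
Proof.
rewrite /tau_of natr_absz (le_trans (ceil_ge _))// ler_int.
exact: ler_norm.
Qed.

(** There are finitely many allocations, so the event is a finite intersection: no [S] that fails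
    envy-freeness is a maximizer. Quantifying over all maximizers covers every tie-breaking rule. *)
Lemma measurable_envy_free_event (d : measure_display) (T : measurableType d)
    (R : realType) (m : nat) (mu : bool -> 'I_m -> R) (h : T -> bool -> 'I_m -> R) :
  (forall nu i, measurable_fun setT (fun w => h w nu i)) ->
  measurable [set w | forall S : {set 'I_m},
                is_maximizer (alg_obj (h w)) S -> envy_free mu S].
Proof.
move=> mh.
have mobj S : measurable_fun setT (fun w => alg_obj (h w) S).
  rewrite /alg_obj; apply: measurable_minr.
    under eq_fun do rewrite bval_diff.
    apply: measurable_sum => i; case: (i \in S) => //.
    exact: measurableT_comp.
  under eq_fun do rewrite -opprB bval_diff.
  apply: measurableT_comp => //; apply: measurable_sum => i; case: (i \in S) => //.
  exact: measurableT_comp.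
rewrite [X in measurable X](_ : _ = \bigcap_(S in [set S | ~ envy_free mu S])
    ~` (\bigcap_(S' in [set: {set 'I_m}])
          [set w | alg_obj (h w) S' <= alg_obj (h w) S])); last first.
  apply/seteqP; split=> [w Ew S /= nS Smax|w Ew S Smax].
    by apply: nS; apply: Ew => S'; exact: Smax.
  by apply: contrapT => nS; apply: (Ew S nS) => S' _; exact: Smax.
apply: fin_bigcap_measurable => [|S _]; first exact: finite_finset.
apply: measurableC; apply: fin_bigcap_measurable => [|S' _].
  exact: finite_finset.
by rewrite -[X in measurable X]setTI; exact: measurable_fun_le.
Qed.

(** * Union bound over agents, items and tails *)

Unset Implicit Arguments.

(* sigma is the noise standard deviation (variance sigma^2 > 0).
   Y nu i t is the t-th query outcome of agent nu on item i. *)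
Theorem theorem1 (R : realType) (d : measure_display) (T : measurableType d)
  (P : probability T R) (m : nat) (mu : bool -> 'I_m -> R)
  (sigma Delta delta : R)
  (Y : bool -> 'I_m -> nat -> {RV P >-> R}) :
  (forall nu i, 0 <= mu nu i <= 1) ->
  0 < sigma -> 0 < Delta -> 0 < delta < 1 ->
  opt_envy_le mu (- Delta) ->
  mutually_independent (fun k : bool * 'I_m * nat => Y k.1.1 k.1.2 k.2) ->
  (forall nu i t A, measurable A ->
     distribution P (Y nu i t) A = normal_prob (mu nu i) sigma A) ->
  let tau := tau_of m sigma delta Delta in
  (* the algorithm uses q = m * tau queries: tau per item, samples t < tau *)
  ((1 - delta)%:E <=
   P [set w | forall S : {set 'I_m},
              is_maximizer (alg_obj (emp_mean tau Y w)) S ->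
              envy_free mu S])%E.
Proof.
move=> _ s0 D0 /andP[d0 d1] opt indY HY /=; set tau := tau_of _ _ _ _.
(* Without items all envies would be 0, against the gap; [eps] below divides by [m]. *)
have m0 : (0 < m)%N by apply: opt_envy_lt0_gt0 opt _; rewrite oppr_lt0.
have mR0 : 0 < m%:R :> R by rewrite ltr0n.
have mR1 : 1 <= m%:R :> R by rewrite ler1n.
set E := [set w | _].
have mY nu i t : measurable_fun setT (Y nu i t) by exact: measurable_funP.
have mE : measurable E.
  apply: measurable_envy_free_event => nu i; rewrite /emp_mean.
  by apply: measurable_funM => //; exact: measurable_sum.
pose L := ln (4 * m%:R / delta).
have L0 : 0 < L by rewrite ln_gt0// ltr_pdivlMr//; lra.
have tauL : 32 * sigma ^+ 2 * L * m%:R ^+ 2 / Delta ^+ 2 <= tau%:R.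
  exact: tau_of_ge.
have tau0 : 0 < tau%:R :> R.
  by apply: lt_le_trans tauL; rewrite divr_gt0 ?mulr_gt0 ?exprn_gt0.
pose eps := Delta / (2 * m%:R).
have e0 : 0 < eps by rewrite divr_gt0// mulr_gt0.
(* The lower bound on [tau] gives even [4 * L] here; the tails call for [L]. *)
have LE : L <= tau%:R * eps ^+ 2 / (2 * sigma ^+ 2).
  apply: (@le_trans _ _ (4 * L)); first by lra.
  rewrite (_ : 4 * L = 32 * sigma ^+ 2 * L * m%:R ^+ 2 / Delta ^+ 2 *
    (eps ^+ 2 / (2 * sigma ^+ 2))); last first.
    by rewrite /eps; field; rewrite !gt_eqF.
  rewrite -[leRHS]mulrA ler_wpM2r// divr_ge0// ?sqr_ge0//.
  by rewrite mulr_ge0// sqr_ge0.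
pose J (nu : bool) (i : 'I_m) := [seq (nu, i, t) | t <- iota 0 tau].
have sJ nu i : size (J nu i) = tau by rewrite size_map size_iota.
have bigJ nu i (F : bool * 'I_m * nat -> R) :
    \sum_(j <- J nu i) F j = \sum_(t < tau) F (nu, i, nat_of_ord t).
  by rewrite big_map -{1}(subn0 tau) big_mkord.
(* The sign given by [k.2] selects the tail; 2 agents, m items and 2 signs make 4 m events. *)
pose A (k : bool * 'I_m * bool) := [set w | tau%:R * eps <=
  (-1) ^+ k.2 * \sum_(j <- J k.1.1 k.1.2)
    (Y j.1.1 j.1.2 j.2 w - mu j.1.1 j.1.2)].
have PA k : (P (A k) <= (delta / (4 * m%:R))%:E)%E.
  rewrite /A -{1}(sJ k.1.1 k.1.2).
  apply: le_trans (normal_sum_tail (X := fun k => Y k.1.1 k.1.2 k.2)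
    (mu := fun j => mu j.1.1 j.1.2) indY _ s0 e0 (sqrr_sign _ _) _) _.
  - by rewrite map_inj_uniq ?iota_uniq// => t t' [].
  - by move=> j B; exact: HY.
  (* By the choice of [L], delta / (4 m) = exp (- L), so [LE] compares the exponents. *)
  rewrite lee_fin sJ -[leRHS]lnK ?posrE ?divr_gt0 ?mulr_gt0// ler_expR.
  rewrite -[delta / _]invf_div lnV ?posrE ?divr_gt0 ?mulr_gt0// -/L.
  by rewrite !mulNr lerN2.
have mA k : measurable (A k).
  rewrite -[A k]setTI; apply: measurable_fun_le => //.
  apply: measurable_funM => //; apply: measurable_sum => j.
  exact: measurable_funB.
(* Outside every [A k] both signs are excluded, so each empirical mean is within [eps] of its true
   value. *)
have good : ~` E `<=` \big[setU/set0]_k A k.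
  apply: subsetCl => w nA; rewrite /E /= => S.
  apply: (@maximizer_envy_free _ _ _ _ eps Delta) => //; last first.
    by rewrite /eps le_eqVlt; apply/orP; left; apply/eqP; field; rewrite gt_eqF.
  move=> nu i.
  have nAk b : ~ A (nu, i, b) w.
    by move=> Aw; apply: nA; rewrite -bigcup_seq; exists (nu, i, b) => //=; exact: mem_index_enum.
  have hE : emp_mean tau Y w nu i - mu nu i =
      tau%:R^-1 * \sum_(j <- J nu i) (Y j.1.1 j.1.2 j.2 w - mu j.1.1 j.1.2).
    rewrite bigJ /= sumrB sumr_const card_ord -[mu nu i *+ _]mulr_natl mulrBr mulKf//.
    by rewrite gt_eqF.
  rewrite hE normrM gtr0_norm ?invr_gt0// ler_pdivrMl// ler_norml.
  have /negP := nAk false; have /negP := nAk true.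
  by rewrite /A/= expr0 expr1 mul1r mulN1r -!ltNge => /ltW ? /ltW ?; lra.
have -> : P E = (1 - P (~` E))%E.
  by rewrite -probability_setC ?setCK//; exact: measurableC.
rewrite EFinB leeB//.
apply: (le_trans (le_measure P _ _ good)).
- by rewrite inE; exact: measurableC.
- by rewrite inE; exact: bigsetU_measurable.
apply: (le_trans (probability_bigsetU_le P _ mA)).
apply: (le_trans (lee_sum _ (fun k _ => PA k))).
rewrite sumEFin lee_fin sumr_const !card_prod card_bool card_ord.
rewrite -[leLHS]mulr_natl !natrM le_eqVlt; apply/orP; left; apply/eqP; field.
by rewrite gt_eqF.
Qed.
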